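(* Suppose that $z=(\alpha,\beta,M)\in Z$ satisfies $|\alpha|\le r$, $|\beta|\le s$, and that there exist $\bar\alpha,\bar\beta\in\mathbb{R}^3$ such that \begin{align*} &M_0(z)+\bar\alpha\otimes\bar\beta=0,\\ &|\bar\alpha||\bar\beta|\le G(z),\\ &(\beta\cdot\bar\beta)\sqrt{r^2-|\alpha|^2}\,|\bar\alpha|=(\alpha\cdot\bar\alpha)\sqrt{s^2-|\beta|^2}\,|\bar\beta|,\\ &(\alpha-\beta)\cdot(\bar\alpha\times\bar\beta)=0. \end{align*} Then $z\in K_{r,s}^{\Lambda,3}$.
   Context: Fix real numbers $r>0$, $s>0$ and $p\in\mathbb{R}$ with $|p|\le rs$ (in the source $p$ is the value at a point of a given pressure function). Let $Z:=\mathbb{R}^3\times\mathbb{R}^3\times\mathbb{R}^{3\times 3}$, with elements written $z=(\alpha,\beta,M)$. For $a,b\in\mathbb{R}^3$, $a\otimes b:=ab^T\in\mathbb{R}^{3\times3}$, $\mathrm{id}$ is the $3\times 3$ identity matrix, $|\cdot|$ the Euclidean norm, $\times$ the cross product. Define $$K_{r,s}:=\{z\in Z:\ M=\alpha\otimes\beta+p\,\mathrm{id},\ |\alpha|=r,\ |\beta|=s\}.$$ The wave cone $\Lambda\subset Z$ is the set of all $\bar z=(\bar\alpha,\bar\beta,\bar M)\in Z$ for which there exist $\xi\in\mathbb{R}^3$, $\xi\neq 0$, and $c\in\mathbb{R}$ such that $$\bar M\xi+c\bar\alpha=0,\quad \bar M^T\xi+c\bar\beta=0,\quad \bar\alpha\cdot\xi=0,\quad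 \bar\beta\cdot\xi=0.$$ The sets of laminates are defined recursively by $K_{r,s}^{\Lambda,0}:=K_{r,s}$ and, for $i\ge 0$, $$K_{r,s}^{\Lambda,i+1}:=\{z\in Z:\ \exists\,\bar z\in\Lambda,\ t_1\le 0\le t_2 \text{ such that } z+t_1\bar z\in K_{r,s}^{\Lambda,i}\text{ and } z+t_2\bar z\in K_{r,s}^{\Lambda,i}\}.$$ Finally, for $z=(\alpha,\beta,M)\in Z$ with $|\alpha|\le r$, $|\beta|\le s$, $$M_0(z):=\alpha\otimes\beta-M+p\,\mathrm{id},\qquad G(z):=\sqrt{(r^2-|\alpha|^2)(s^2-|\beta|^2)}.$$ *)

(* Defs.v *)
From HB Require Import structures.
From mathcomp Require Import all_boot all_order all_algebra.
From mathcomp Require Import classical_sets reals.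

Set Implicit Arguments.
Unset Strict Implicit.
Unset Printing Implicit Defensive.

Import Order.TTheory GRing.Theory Num.Theory.
Local Open Scope classical_set_scope.
Local Open Scope ring_scope.

Section Laminates.
Context {R : realType}.

Definition dot (u v : 'cV[R]_3) : R := \sum_i u i 0 * v i 0.

(* The library's `|_| on matrices is the sup norm, hence this definition. *)
Definition enorm (u : 'cV[R]_3) : R := Num.sqrt (dot u u).

(* Indices live in 'I_3, where addition is modulo 3. *)
Definition cross (u v : 'cV[R]_3) : 'cV[R]_3 :=
  \col_i (u (i + 1) 0 * v (i + 2) 0 - u (i + 2) 0 * v (i + 1) 0).

Definition tensor (a b : 'cV[R]_3) : 'M[R]_3 := a *m b^T.

(* Points are written (alpha, beta, M); the vector space structure is the
   product one. *)
Definition Z : lmodType R := ('cV[R]_3 * 'cV[R]_3 * 'M[R]_3)%type.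

Definition K (r s p : R) : set Z :=
  [set z | let: (alpha, beta, M) := z in
    [/\ M = tensor alpha beta + p%:M, enorm alpha = r & enorm beta = s]].

Definition wave_cone : set Z :=
  [set z | let: (alpha, beta, M) := z in
    exists xi : 'cV[R]_3, exists c : R,
      xi <> 0 /\
      [/\ M *m xi + c *: alpha = 0, M^T *m xi + c *: beta = 0,
          dot alpha xi = 0 & dot beta xi = 0]].

Fixpoint laminate (r s p : R) (i : nat) : set Z :=
  if i is j.+1 then
    [set z | exists zbar : Z, exists t1 t2 : R,
      [/\ wave_cone zbar, t1 <= 0 <= t2,
          laminate r s p j (z + t1 *: zbar) &
          laminate r s p j (z + t2 *: zbar)]]
  else K r s p.

Definition M0 (p : R) (z : Z) : 'M[R]_3 :=
  let: (alpha, beta, M) := z in tensor alpha beta - M + p%:M.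

Definition G (r s : R) (z : Z) : R :=
  let: (alpha, beta, _) := z in
  Num.sqrt ((r ^+ 2 - enorm alpha ^+ 2) * (s ^+ 2 - enorm beta ^+ 2)).

End Laminates.

Arguments Z R : clear implicits.

(* Main.v *)
Require Import Defs.
From mathcomp Require Import all_boot all_order all_algebra.
From mathcomp Require Import classical_sets reals.
From mathcomp Require Import ring lra.

(** Write [M = alpha (x) beta + p id + abar (x) bbar], let
    [a^2 = r^2 - |alpha|^2], [b^2 = s^2 - |beta|^2], and rescale [abar], [bbar]
    to [A], [B] with [|A| = a], [|B| = b]. The third hypothesis makes the
    equations [|alpha + t A| = r] and [|beta + t B| = s] the same quadratic
    [t^2 + 2 k t = 1]; its two roots exhibit
    [(alpha, beta, alpha (x) beta + p id + A (x) B)] as a first-order laminate.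
    Moving [alpha] alone, then [beta] alone, shows that
    [(alpha, beta, alpha (x) beta + p id)] is a second-order laminate.
    The given point lies between these two, in the direction
    [(0, 0, A (x) B)] of the wave cone, and equals the second one when [abar]
    or [bbar] vanishes. *)

Import Order.TTheory GRing.Theory Num.Theory.
Local Open Scope ring_scope.

(** * Inner products, rank-one matrices and orthogonal vectors in three dimensions *)

Section Vectors.
Context {R : realType}.
Implicit Types (u v w a b : 'cV[R]_3) (t : R).

Lemma dotC u v : dot u v = dot v u.
Proof. by apply: eq_bigr => i _; rewrite mulrC. Qed.

Lemma dotDl u v w : dot (u + v) w = dot u w + dot v w.
Proof. by rewrite -big_split; apply: eq_bigr => i _; rewrite mxE mulrDl. Qed.

Lemma dotZl t u v : dot (t *: u) v = t * dot u v.
Proof. by rewrite big_distrr; apply: eq_bigr => i _; rewrite mxE /= mulrA. Qed.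

Lemma dotDr u v w : dot w (u + v) = dot w u + dot w v.
Proof. by rewrite ![dot w _]dotC dotDl. Qed.

Lemma dotZr t u v : dot u (t *: v) = t * dot u v.
Proof. by rewrite ![dot u _]dotC dotZl. Qed.

Lemma dot0l u : dot 0 u = 0.
Proof. by rewrite -(scale0r 0) dotZl mul0r. Qed.

Lemma dot_ge0 u : 0 <= dot u u.
Proof. by apply: sumr_ge0 => i _; rewrite -expr2 sqr_ge0. Qed.

Lemma dot_eq0 u : (dot u u == 0) = (u == 0).
Proof.
apply/idP/eqP => [|->]; last by rewrite dot0l.
rewrite psumr_eq0 => [/allP h|i _]; last by rewrite -expr2 sqr_ge0.
apply/colP => i; rewrite mxE; apply/eqP.
by have := h i (mem_index_enum i); rewrite mulf_eq0 orbb.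
Qed.

Lemma enorm_ge0 u : 0 <= enorm u.
Proof. exact: sqrtr_ge0. Qed.

Lemma enorm_sqr u : enorm u ^+ 2 = dot u u.
Proof. by rewrite sqr_sqrtr ?dot_ge0. Qed.

Lemma enorm_eq0 u : (enorm u == 0) = (u == 0).
Proof. by rewrite -sqrf_eq0 enorm_sqr dot_eq0. Qed.

Lemma enormP u t : 0 <= t -> dot u u = t ^+ 2 -> enorm u = t.
Proof. by move=> t0 h; rewrite /enorm h sqrtr_sqr ger0_norm. Qed.

Lemma tensorE a b i j : tensor a b i j = a i 0 * b j 0.
Proof. by rewrite mxE big_ord1 mxE. Qed.

Lemma tr_tensor a b : (tensor a b)^T = tensor b a.
Proof. by rewrite /tensor trmx_mul trmxK. Qed.

Lemma tensor_mulmx a b u : tensor a b *m u = dot b u *: a.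
Proof.
apply/colP => i; rewrite !mxE mulr_suml; apply: eq_bigr => j _.
by rewrite tensorE; ring.
Qed.

Lemma tensorZ (x y : R) a b :
  tensor (x *: a) (y *: b) = (x * y) *: tensor a b.
Proof. by apply/matrixP => i j; rewrite !(tensorE, mxE); ring. Qed.

Lemma tensor0l b : tensor 0 b = 0.
Proof. by rewrite /tensor mul0mx. Qed.

Lemma tensor0r a : tensor a 0 = 0.
Proof. by rewrite /tensor trmx0 mulmx0. Qed.

(** The triple product is the determinant of the matrix with columns [u], [v], [w]; a nonzero vector
    of its left kernel is orthogonal to all three columns. *)
Lemma triple_product_eq0 u v w : dot u (cross v w) = 0 ->
  exists xi, [/\ xi != 0, dot u xi = 0, dot v xi = 0 & dot w xi = 0].
Proof.
move=> h.
pose D : 'M[R]_3 := \matrix_(i, j) (nth 0 [:: u; v; w] j) i 0.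
have /eqP/det0P [x x0 xD] : \det D = 0.
  (* Entries become values of functions on [nat], so that the same index reached through different
     ordinal expressions computes to one numeral and [ring] can match terms. *)
  have coord (y : 'cV[R]_3) : exists f : nat -> R, forall i, y i 0 = f i.
    by exists (fun n => y (inord n) 0) => i; rewrite inord_val.
  have [[[f fE] [g gE]] [k kE]] := (coord u, coord v, coord w).
  rewrite -{}h /dot (expand_det_col _ 0) !big_ord_recl !big_ord0 /cofactor.
  rewrite !(expand_det_row _ 0) !big_ord_recl !big_ord0 /cofactor !det_mx11.
  rewrite !mxE /= !(fE, gE, kE) /= /bump /=.
  ring.
exists x^T; have orth (j : 'I_3) : dot (nth 0 [:: u; v; w] j) x^T = 0.
  have /rowP/(_ j) := xD; rewrite !mxE => <-.
  by apply: eq_bigr => i _; rewrite !mxE mulrC.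
split; [|exact: (orth 0)|exact: (orth 1)|exact: (orth 2%:R)].
by apply: contra x0 => /eqP xT0; rewrite -[x]trmxK xT0 trmx0.
Qed.

Lemma orthogonal_pair v w :
  exists xi, [/\ xi != 0, dot v xi = 0 & dot w xi = 0].
Proof.
have [xi [xi0 _ hv hw]] := triple_product_eq0 0 v w (dot0l _).
by exists xi.
Qed.

Lemma orthogonal_enorm u t : 0 <= t ->
  exists e, dot u e = 0 /\ dot e e = t ^+ 2.
Proof.
move=> t0; have [xi [xi0 h _]] := orthogonal_pair u 0.
exists ((t / enorm xi) *: xi); rewrite dotZr h mulr0; split=> //.
have n0 : enorm xi != 0 by rewrite enorm_eq0.
by rewrite dotZl dotZr -enorm_sqr; field.
Qed.

End Vectors.

(** * Directions of the wave cone, and laminates of first and second order *)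

Section Laminates.
Context {R : realType} {r s p : R}.
Implicit Types (a b alpha beta : 'cV[R]_3) (M N : 'M[R]_3) (t : R).

Lemma laminate_combine j alpha beta M a b N t1 t2 :
  wave_cone (a, b, N) -> t1 <= 0 <= t2 ->
  laminate r s p j (alpha + t1 *: a, beta + t1 *: b, M + t1 *: N) ->
  laminate r s p j (alpha + t2 *: a, beta + t2 *: b, M + t2 *: N) ->
  laminate r s p j.+1 (alpha, beta, M).
Proof. by move=> *; exists (a, b, N), t1, t2. Qed.

(** The zero direction lies in the wave cone, so a degenerate segment with [t1 = t2 = 0]
    suffices. *)
Lemma laminate_subS j (z : Z R) : laminate r s p j z -> laminate r s p j.+1 z.
Proof.
move: z => [[alpha beta] M] h.
have [xi [/eqP xi0 _ _]] := orthogonal_pair (0 : 'cV[R]_3) 0.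
apply: (@laminate_combine _ _ _ _ 0 0 0 0 0); 
  rewrite ?lexx ?scaler0 ?addr0 //.
exists xi, 0; split=> //.
by rewrite !dot0l trmx0 !mul0mx !scale0r addr0.
Qed.

Lemma wave_cone_intro a b N (xi : 'cV[R]_3) (c : R) : xi != 0 ->
  N *m xi + c *: a = 0 -> N^T *m xi + c *: b = 0 ->
  dot a xi = 0 -> dot b xi = 0 -> wave_cone (a, b, N).
Proof. by move=> /eqP xi0 *; exists xi, c. Qed.

(** This is the direction in which [alpha] moves alone. With [xi] orthogonal to [a], the choice
    [c = - dot beta xi] cancels the only surviving term. *)
Lemma wave_cone_l a beta : wave_cone (a, 0 : 'cV[R]_3, tensor a beta).
Proof.
have [xi [xi0 h _]] := orthogonal_pair a 0.
apply: (wave_cone_intro _ _ _ xi (- dot beta xi)); rewrite ?dot0l //.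
  by rewrite tensor_mulmx scaleNr subrr.
by rewrite tr_tensor tensor_mulmx h scale0r scaler0 addr0.
Qed.

Lemma wave_cone_r alpha b : wave_cone (0 : 'cV[R]_3, b, tensor alpha b).
Proof.
have [xi [xi0 h _]] := orthogonal_pair b 0.
apply: (wave_cone_intro _ _ _ xi (- dot alpha xi)); rewrite ?dot0l //.
  by rewrite tensor_mulmx h scale0r scaler0 addr0.
by rewrite tr_tensor tensor_mulmx scaleNr subrr.
Qed.

Lemma wave_cone_tensor a b :
  wave_cone (0 : 'cV[R]_3, 0 : 'cV[R]_3, tensor a b).
Proof.
have [xi [xi0 ha hb]] := orthogonal_pair a b.
apply: (wave_cone_intro _ _ _ xi 0); rewrite ?dot0l // scale0r addr0.
  by rewrite tensor_mulmx hb scale0r.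
by rewrite tr_tensor tensor_mulmx ha scale0r.
Qed.

Lemma enormDorth alpha e t : 0 <= t -> dot alpha e = 0 ->
  dot e e = t ^+ 2 - enorm alpha ^+ 2 ->
  enorm (alpha + e) = t /\ enorm (alpha - e) = t.
Proof.
rewrite enorm_sqr -[- e]scaleN1r => t0 h he.
by split; apply: enormP => //;
  rewrite !dotDl !dotDr ?dotZl ?dotZr ?(dotC e) h he; ring.
Qed.

(** By Pythagoras, [beta] is the midpoint of two points [beta - e], [beta + e] of the sphere of
    radius [s], with [e] orthogonal to [beta]. The product [tensor alpha beta] is linear in [beta],
    so the matrix constraint persists. *)
Lemma laminate1_tensor alpha beta : 0 <= s -> enorm alpha = r ->
  enorm beta <= s -> laminate r s p 1 (alpha, beta, tensor alpha beta + p%:M).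
Proof.
move=> s0 ha hb.
have hb2 : 0 <= s ^+ 2 - enorm beta ^+ 2.
  by rewrite subr_ge0 lerXn2r ?nnegrE ?enorm_ge0.
have [e [he]] := orthogonal_enorm beta _ (sqrtr_ge0 (s ^+ 2 - enorm beta ^+ 2)).
rewrite sqr_sqrtr // => /(enormDorth _ _ _ s0 he) [h1 h2].
apply: (@laminate_combine _ _ _ _ 0 e (tensor alpha e) (-1) 1).
- exact: wave_cone_r.
- by rewrite lerN10 ler01.
- split; rewrite ?scaler0 ?scaleN1r ?addr0 //.
  by apply/matrixP => i j; rewrite !(tensorE, mxE); ring.
split; rewrite ?scaler0 ?scale1r ?addr0 //.
by apply/matrixP => i j; rewrite !(tensorE, mxE); ring.
Qed.

Lemma laminate2_tensor alpha beta : 0 <= r -> 0 <= s ->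
  enorm alpha <= r -> enorm beta <= s ->
  laminate r s p 2 (alpha, beta, tensor alpha beta + p%:M).
Proof.
move=> r0 s0 ha hb.
have ha2 : 0 <= r ^+ 2 - enorm alpha ^+ 2.
  by rewrite subr_ge0 lerXn2r ?nnegrE ?enorm_ge0.
have [e [he]] :=
  orthogonal_enorm alpha _ (sqrtr_ge0 (r ^+ 2 - enorm alpha ^+ 2)).
rewrite sqr_sqrtr // => /(enormDorth _ _ _ r0 he) [h1 h2].
apply: (@laminate_combine _ _ _ _ e 0 (tensor e beta) (-1) 1).
- exact: wave_cone_l.
- by rewrite lerN10 ler01.
- rewrite scaler0 addr0 scaleN1r.
  rewrite (_ : _ + _ *: tensor _ _ = tensor (alpha - e) beta + p%:M).
    exact: laminate1_tensor.
  by apply/matrixP => i j; rewrite !(tensorE, mxE); ring.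
rewrite scaler0 addr0 scale1r.
rewrite (_ : _ + _ *: tensor _ _ = tensor (alpha + e) beta + p%:M).
  exact: laminate1_tensor.
by apply/matrixP => i j; rewrite !(tensorE, mxE); ring.
Qed.

(** The vanishing triple product gives [xi] orthogonal to [a] and [b] with
    [dot alpha xi = dot beta xi]; hence a single [c] solves both matrix equations of the wave
    cone. *)
Lemma laminate1_extremal alpha beta a b k : 0 <= r -> 0 <= s ->
  dot a a = r ^+ 2 - enorm alpha ^+ 2 -> dot b b = s ^+ 2 - enorm beta ^+ 2 ->
  dot alpha a = k * dot a a -> dot beta b = k * dot b b ->
  dot (alpha - beta) (cross a b) = 0 ->
  laminate r s p 1 (alpha, beta, tensor alpha beta + p%:M + tensor a b).
Proof.
rewrite !enorm_sqr => r0 s0 ha hb ka kb.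
move=> /triple_product_eq0 [xi [xi0 hab hxa hxb]].
(* Replacing [t ^+ 2] by [1 - 2 * k * t] in [tensor (alpha + t *: a) (beta + t *: b)] leaves an
   expression affine in [t], with slope [N]. *)
pose N := tensor alpha b + tensor a beta - (2 * k) *: tensor a b.
have endpoint t : t ^+ 2 = 1 - 2 * k * t ->
    K r s p (alpha + t *: a, beta + t *: b,
             tensor alpha beta + p%:M + tensor a b + t *: N).
  move=> ht; split.
  - apply/matrixP => i j; rewrite !(tensorE, mxE).
    transitivity (alpha i 0 * beta j 0 + t * alpha i 0 * b j 0
      + t * a i 0 * beta j 0 + (1 - 2 * k * t) * (a i 0 * b j 0)
      + p *+ (i == j)); first by ring.
    by rewrite -ht; ring.
  - apply: enormP => //; rewrite !(dotDl, dotDr, dotZl, dotZr) (dotC a) ka.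
    transitivity (dot alpha alpha + (t ^+ 2 + 2 * k * t) * dot a a).
      by ring.
    by rewrite ht ha; ring.
  - apply: enormP => //; rewrite !(dotDl, dotDr, dotZl, dotZr) (dotC b) kb.
    transitivity (dot beta beta + (t ^+ 2 + 2 * k * t) * dot b b).
      by ring.
    by rewrite ht hb; ring.
have k1 : 0 <= k ^+ 2 + 1 by rewrite addr_ge0 ?sqr_ge0.
pose q := Num.sqrt (k ^+ 2 + 1).
have q2 : q ^+ 2 = k ^+ 2 + 1 by rewrite sqr_sqrtr.
(* This bound puts the roots [- k - q] and [- k + q] on either side of zero. *)
have /ler_normlP [kq kq'] : `|k| <= q.
  by rewrite -sqrtr_sqr ler_wsqrtr // lerDl.
apply: (@laminate_combine _ _ _ _ a b N (- k - q) (- k + q)).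
- have hab' : dot alpha xi = dot beta xi.
    by apply/eqP; rewrite -subr_eq0 -mulN1r -dotZl -dotDl scaleN1r hab.
  apply: (wave_cone_intro _ _ _ xi (- dot alpha xi)) => //.
    rewrite /N !mulmxDl mulNmx -scalemxAl !tensor_mulmx hxb hab'.
    by rewrite !scale0r scaler0 subr0 add0r scaleNr subrr.
  rewrite /N !linearD linearN linearZ /= !tr_tensor.
  rewrite !mulmxDl mulNmx -scalemxAl !tensor_mulmx hxa.
  by rewrite !scale0r scaler0 subr0 addr0 scaleNr subrr.
- by apply/andP; split; lra.
- by apply: endpoint; rewrite sqrrB q2; ring.
by apply: endpoint; rewrite sqrrD q2; ring.
Qed.

End Laminates.

(** * Rescaling of the rank-one term and the final segment *)

Theorem proposition2p1 (R : realType) (r s p : R)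
    (hr : 0 < r) (hs : 0 < s) (hp : `|p| <= r * s)
    (alpha beta : 'cV[R]_3) (M : 'M[R]_3)
    (halpha : enorm alpha <= r) (hbeta : enorm beta <= s)
    (hz : exists abar bbar : 'cV[R]_3,
      [/\ M0 p (alpha, beta, M) + tensor abar bbar = 0,
          enorm abar * enorm bbar <= G r s (alpha, beta, M),
          dot beta bbar * Num.sqrt (r ^+ 2 - enorm alpha ^+ 2) * enorm abar
            = dot alpha abar * Num.sqrt (s ^+ 2 - enorm beta ^+ 2) * enorm bbar
        & dot (alpha - beta) (cross abar bbar) = 0]) :
  laminate r s p 3 (alpha, beta, M).
Proof.
have r0 := ltW hr; have s0 := ltW hs.
have [a [b [hM hG hab hx]]] := hz.
have lam2 := laminate2_tensor (p := p) alpha beta r0 s0 halpha hbeta.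
have {hM} -> : M = tensor alpha beta + p%:M + tensor a b.
  apply/eqP; rewrite -subr_eq0 -oppr_eq0 -hM; apply/eqP.
  by apply/matrixP => i j; rewrite !(tensorE, mxE); ring.
have [->|a0] := eqVneq a 0.
  by rewrite tensor0l addr0; apply: laminate_subS.
have [->|b0] := eqVneq b 0.
  by rewrite tensor0r addr0; apply: laminate_subS.
have na : 0 < enorm a by rewrite lt_def enorm_eq0 a0 enorm_ge0.
have nb : 0 < enorm b by rewrite lt_def enorm_eq0 b0 enorm_ge0.
have ha2 : 0 <= r ^+ 2 - enorm alpha ^+ 2.
  by rewrite subr_ge0 lerXn2r ?nnegrE ?enorm_ge0.
have hb2 : 0 <= s ^+ 2 - enorm beta ^+ 2.
  by rewrite subr_ge0 lerXn2r ?nnegrE ?enorm_ge0.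
move: hG hab; rewrite /G sqrtrM //.
set x := Num.sqrt _; set y := Num.sqrt _ => hG hab.
have x2 : x ^+ 2 = r ^+ 2 - enorm alpha ^+ 2 by rewrite sqr_sqrtr.
have y2 : y ^+ 2 = s ^+ 2 - enorm beta ^+ 2 by rewrite sqr_sqrtr.
(* As [a] and [b] are nonzero, the bound by [G] forces [alpha] and [beta] strictly inside their
   balls. *)
have xy : 0 < x * y by apply: lt_le_trans hG; rewrite mulr_gt0.
have x0 : x != 0 by apply: contraTneq xy => ->; rewrite mul0r ltxx.
have y0 : y != 0 by apply: contraTneq xy => ->; rewrite mulr0 ltxx.
have na0 := lt0r_neq0 na; have nb0 := lt0r_neq0 nb.
pose A := (x / enorm a) *: a; pose B := (y / enorm b) *: b.
have lam1 : laminate r s p 1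
    (alpha, beta, tensor alpha beta + p%:M + tensor A B).
  have AA : dot A A = x ^+ 2 by rewrite dotZl dotZr -enorm_sqr; field.
  have BB : dot B B = y ^+ 2 by rewrite dotZl dotZr -enorm_sqr; field.
  (* This value is [dot alpha A / dot A A]; the third hypothesis says that it equals
     [dot beta B / dot B B]. *)
  apply: (laminate1_extremal _ _ _ _ (dot alpha a / (x * enorm a))) => //.
  - by rewrite AA.
  - by rewrite BB.
  - by rewrite AA dotZr; field; rewrite na0 x0.
  - rewrite BB dotZr.
    have -> : dot beta b = dot alpha a * y * enorm b / (x * enorm a).
      by rewrite -hab; field; rewrite na0 x0.
    by field; rewrite na0 nb0 x0.
  - rewrite (_ : cross A B = (x / enorm a * (y / enorm b)) *: cross a b).
      by rewrite dotZr hx mulr0.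
    by apply/colP => i; rewrite !mxE; ring.
(* The position on the segment from [0] to [tensor A B]: the bound by [G], which is [x * y], amounts
   to [l <= 1]. *)
pose l := enorm a * enorm b / (x * y).
have l0 : 0 <= l by rewrite divr_ge0 ?mulr_ge0 ?enorm_ge0 ?sqrtr_ge0.
have l1 : l <= 1 by rewrite ler_pdivrMr // mul1r.
have -> : tensor a b = l *: tensor A B.
  rewrite tensorZ scalerA (_ : l * _ = 1) ?scale1r //.
  by rewrite /l; field; rewrite na0 nb0 x0 y0.
apply: (@laminate_combine _ _ _ _ _ _ _ _ 0 0 (tensor A B) (- l) (1 - l)).
- exact: wave_cone_tensor.
- by rewrite oppr_le0 l0 subr_ge0.
- by rewrite !scaler0 !addr0 scaleNr addrK; apply: lam2.
rewrite !scaler0 !addr0 -addrA -scalerDl [l + _]addrC subrK scale1r.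
(* The first-order endpoint is raised to order two to match the other one. *)
exact: laminate_subS.
Qed.
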